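(* Let $\lambda=(\lambda_1,\lambda_2,\ldots,\lambda_\ell)$ be a (nonempty) partition written in non-decreasing order. Then the following are equivalent: (i) $\lambda$ is a palindromic-gap partition. (ii) $\lambda_i+\lambda_{\ell+1-i}=\lambda_1+\lambda_\ell$ for all $1\le i\le\ell$. (iii) When Ferrers diagrams are drawn with left-justified rows, the Ferrers diagram of $\lambda$ is self-complementary under a $180^\circ$ rotation inside the rectangle of dimensions $\ell\times(\lambda_1+\lambda_\ell)$.
   Context: A partition is a finite sequence $\lambda=(\lambda_1,\dots,\lambda_\ell)$ of positive integers written in non-decreasing order. It is a palindromic-gap partition if $\lambda_{i+1}-\lambda_i=\lambda_{\ell-i+1}-\lambda_{\ell-i}$ for all $1\le i\le\ell-1$ (vacuously true if $\ell=1$). The Ferrers diagram of $\lambda$ inside the rectangle with $\ell$ rows and $C=\lambda_1+\lambda_\ell$ columns consists of the cells $(i,j)$ with $1\le i\le\ell$ and $1\le j\le\lambda_i$ (row $i$ has $\lambda_i$ left-justified cells). A Ferrers diagram is self-complementary inside a rectangle (under a $180^\circ$ rotation) if taking its complement in the rectangle and rotating the complement by $180^\circ$ (i.e. applying $(i,j)\mapsto(\ell+1-i,\,C+1-j)$) recovers the original diagram. *)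

(* Defs.v *)
From mathcomp Require Import all_boot all_order all_algebra.

Set Implicit Arguments.
Unset Strict Implicit.
Unset Printing Implicit Defensive.

(* Parts are listed in non-decreasing order, the reverse of the usual
   convention for integer partitions. *)
Definition is_partition (s : seq nat) : bool :=
  sorted leq s && all (fun x => 0 < x) s.

(* The i-th part with 1-based indexing; only used for 1 <= i <= size s. *)
Definition part (s : seq nat) (i : nat) : nat := nth 0 s i.-1.

(* The differences are taken in int, so that they are not truncated. *)
Definition palindromic_gap (s : seq nat) : Prop :=
  forall i : nat, 1 <= i <= size s - 1 ->
    ((part s (i + 1))%:Z - (part s i)%:Z =
     (part s (size s - i + 1))%:Z - (part s (size s - i))%:Z)%R.

(* The cells of a rectangle with m rows and n columns are pairs of ordinals:
   (i, j) : 'I_m * 'I_n is the cell in row i + 1 and column j + 1.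
   The diagram is truncated if C is smaller than some part of s. *)
Definition ferrers (s : seq nat) (C : nat) : {set 'I_(size s) * 'I_C} :=
  [set c : 'I_(size s) * 'I_C | c.2.+1 <= part s c.1.+1].

(* In 1-based coordinates, (i, j) |-> (m + 1 - i, n + 1 - j). *)
Definition rot180 (m n : nat) (c : 'I_m * 'I_n) : 'I_m * 'I_n :=
  (rev_ord c.1, rev_ord c.2).

Definition self_complementary (m n : nat) (D : {set 'I_m * 'I_n}) : Prop :=
  [set rot180 c | c in ~: D] = D.

(* Main.v *)
Require Import Defs.
From mathcomp Require Import all_boot all_order all_algebra.
From mathcomp Require Import zify.

(** Write [l] for the length and [C] for the sum of the first and last parts.
    The gap condition at [i] rearranges to
    [part i + part (l + 1 - i) = part (i + 1) + part (l - i)], that is, the sum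
    of the two parts symmetric about the middle does not change when [i] grows
    by one.  So palindromic gaps say exactly that these sums are constant, and
    their common value is the sum [C] at [i = 1].

    On the diagram side, rotating the complement turns row [l + 1 - i], with
    its [C - part (l + 1 - i)] missing cells, into a left-justified row [i] of
    that length.  Since the parts are weakly increasing, no part exceeds [C], so no row is
    truncated by the rectangle and a row is determined by its length: the two
    diagrams agree if and only if [part i = C - part (l + 1 - i)] for all [i]
    (lemma [self_complementary_ferrers]). *)

(** The rotation is an involution, so the image of the complement is also its
    preimage. *)
Lemma mem_rot180_compl m n (D : {set 'I_m * 'I_n}) (c : 'I_m * 'I_n) :
  (c \in [set rot180 d | d in ~: D]) = (rot180 c \notin D).
Proof.
have rotK : involutive (@rot180 m n).
  by move=> [i j]; rewrite /rot180 /= !rev_ordK.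
by rewrite -[c in LHS]rotK (mem_imset _ _ (inv_inj rotK)) inE.
Qed.

Lemma part_le_last (s : seq nat) (i : nat) :
  sorted leq s -> 1 <= i <= size s -> part s i <= part s (size s).
Proof.
move=> s_sorted i_range.
by apply: (sorted_leq_nth leq_trans leqnn) => //; rewrite ?inE; lia.
Qed.

Lemma palindromic_gapP (s : seq nat) :
  palindromic_gap s <->
  (forall i, 1 <= i <= size s ->
     part s i + part s (size s + 1 - i) = part s 1 + part s (size s)).
Proof.
split=> [gap i | sum_const i i_range].
- elim: i => [|[|i] IHi] // i_range; first by rewrite addnK.
  have {}IHi := IHi ltac:(lia); have := gap i.+1 ltac:(lia).
  move: IHi; rewrite (addn1 i.+1).
  have -> : size s - i.+1 + 1 = size s + 1 - i.+1 by lia.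
  have -> : size s + 1 - i.+2 = size s - i.+1 by lia.
  lia.
- have := sum_const i ltac:(lia); have := sum_const (i + 1) ltac:(lia).
  have -> : size s + 1 - (i + 1) = size s - i by lia.
  have -> : size s + 1 - i = size s - i + 1 by lia.
  lia.
Qed.

(** The bound on the parts keeps every row inside the rectangle.  Without it, a
    truncated row no longer determines its part. *)
Lemma self_complementary_ferrers (s : seq nat) (C : nat) :
  (forall i, 1 <= i <= size s -> part s i <= C) ->
  self_complementary (ferrers s C) <->
  (forall i, 1 <= i <= size s -> part s i + part s (size s + 1 - i) = C).
Proof.
move=> part_le; split=> [selfC [|i] // i_range | sum_const].
- have i_lt : i < size s by lia.
  have row j : j < C ->
      (j < part s i.+1) = (part s (size s + 1 - i.+1) <= C - j.+1).
    move=> j_lt.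
    have := mem_rot180_compl _ _ (ferrers s C) (Ordinal i_lt, Ordinal j_lt).
    rewrite selfC !inE /= -leqNgt.
    by have -> : (size s - i.+1).+1 = size s + 1 - i.+1 by lia.
  have p_le := part_le i.+1 ltac:(lia).
  have q_le := part_le (size s + 1 - i.+1) ltac:(lia).
  move: (part s i.+1) (part s (size s + 1 - i.+1)) p_le q_le row => p q p_le q_le row.
  (* If the row lengths [p] and [C - q] differ, the column whose 0-based index
     is the smaller of the two lies in exactly one of the rows. *)
  by have := row p; have := row (C - q); lia.
- apply/setP=> -[i j]; rewrite mem_rot180_compl !inE /= -leqNgt.
  have i_lt := ltn_ord i; have j_lt := ltn_ord j.
  have := sum_const i.+1 ltac:(lia).
  have -> : size s + 1 - i.+1 = (size s - i.+1).+1 by lia.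
  lia.
Qed.

Theorem theorem13 (s : seq nat) (s_part : is_partition s) (s_nonempty : s <> [::]) :
  [<-> palindromic_gap s;
       forall i : nat, 1 <= i <= size s ->
         part s i + part s (size s + 1 - i) = part s 1 + part s (size s);
       self_complementary (ferrers s (part s 1 + part s (size s)))].
Proof.
have [s_sorted _] := andP s_part.
have part_le i : 1 <= i <= size s -> part s i <= part s 1 + part s (size s).
  by move=> i_range; rewrite (leq_trans (part_le_last _ _ s_sorted i_range)) ?leq_addl.
have ferrersE := self_complementary_ferrers _ _ part_le.
tfae.
- by move/palindromic_gapP.
- by move/ferrersE.
- by move/ferrersE/palindromic_gapP.
Qed.
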